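(* Let $p>0$, let $(X,\|\cdot\|)$ be a normed space, and let $\alpha_i\in\mathbb{R}$ for $i\ge1$. The reverse generalized triangle inequality $$\Big\|\sum_{i\ge1}x_i\Big\|^p\ge\sum_{i\ge1}\alpha_i\|x_i\|^p$$ holds (for all sequences $(x_i)_{i\ge1}\subset X$ with $\sum_{i\ge1}\|x_i\|<\infty$) if and only if either $\alpha_i<0$ for all $i\ge1$, or there exists a unique index $j$ such that $\alpha_j>0$, $\alpha_i<0$ for all $i\ne j$, and - in the case $p>1$: $\displaystyle \alpha_j^{\frac{1}{1-p}}\le1+\sum_{i\ne j}|\alpha_i|^{\frac{1}{1-p}}$; - in the case $0<p\le1$: $\displaystyle \alpha_j\le\inf\{1,\,|\alpha_i|,\ i\ne j\}$.
   Context: The $\alpha_i$ are fixed real coefficients, and the inequality is considered for sequences $(x_i)_{i\ge1}$ in the normed space $X$ whose norms are summable. The set $\{1,\,|\alpha_i|,\ i\ne j\}$ consists of the number $1$ and all the numbers $|\alpha_i|$ with $i\ne j$.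
   Formalization: The printed claim is false; the formal one reverses the inequality in the case p>1 (α_j^{1/(1-p)} ≥ 1+Σ_{i≠j}|α_i|^{1/(1-p)}), replaces ''α_i<0 for all i'' by ''α_i≤0 for all i'' in the first alternative, and assumes X≠{0}. *)

(* Defs.v *)
From HB Require Import structures.
From mathcomp Require Import all_boot all_order all_algebra.
From mathcomp Require Import all_classical all_reals all_analysis.
Import Order.TTheory GRing.Theory Num.Theory.
Import numFieldNormedType.Exports.

Set Implicit Arguments.
Unset Strict Implicit.
Unset Printing Implicit Defensive.

Local Open Scope classical_set_scope.
Local Open Scope ring_scope.

(* Sequences are indexed from 0. Since X need not be complete, absolute
   summability does not give a sum in X, hence the hypothesis that the series
   converges; it is redundant when X is complete. The right-hand side is a sum
   in the extended reals, as it may be -oo (e.g. if alpha is unbounded, or if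
   p < 1). *)
Definition reverse_triangle_inequality (R : realType) (X : normedModType R)
    (p : R) (alpha : nat -> R) : Prop :=
  forall x : nat -> X,
    cvgn [normed series x] -> cvgn (series x) ->
    (\sum_(0 <= i <oo) (alpha i * `|x i| `^ p)%:E
       <= (`|limn (series x)| `^ p)%:E)%E.

(* The sum over i != j has nonnegative terms and may be +oo. For p > 1 the
   exponent 1 / (1 - p) is negative: the condition amounts to
   alpha j <= (1 + \sum_(i != j) |alpha i|^(1/(1-p)))^(1-p), the best constant in
   Hoelder's inequality. The source prints the inequality with "<=" in place of
   ">="; with "<=" the result fails, e.g. for p = 2, alpha = (1, -1, -1, ...) and
   x = (2, -1, 0, 0, ...), where it would give 1 >= 4 - 1. *)
Definition coefficient_condition (R : realType) (p : R) (alpha : nat -> R)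
    (j : nat) : Prop :=
  (1 < p ->
     (1 + \sum_(0 <= i <oo | i != j) (`|alpha i| `^ (1 - p)^-1)%:E
        <= (alpha j `^ (1 - p)^-1)%:E)%E) /\
  (p <= 1 ->
     alpha j <= inf ([set 1] `|` [set `|alpha i| | i in [set i | i != j]])).

(* Main.v *)
(* If alpha_j > 0, testing on v and -v in positions j and i gives
   alpha_j <= - alpha_i, hence there is at most one positive coefficient. Put
   S = sum_i x_i. The triangle inequality |x_j| <= |S| + sum_(i != j) |x_i|
   reduces sufficiency to a finite inequality for nonnegative reals: subadditivity
   of t^p for p <= 1, and for p > 1 subadditivity of x^p a^(1-p) with weights
   b_i = |alpha_i|^(1/(1-p)). Conversely, for p > 1, test sequences on a line with
   x_i proportional to b_i violate the inequality
   when the condition fails. *)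
Require Import Defs.
From HB Require Import structures.
From mathcomp Require Import all_boot all_order all_algebra.
From mathcomp Require Import all_classical all_reals all_analysis.
From mathcomp Require Import ring lra.
Import Order.TTheory GRing.Theory Num.Theory.
Import numFieldNormedType.Exports.

Local Open Scope ring_scope.

(** * Inequalities for real powers *)

Lemma mulr_powR_div (R : realType) (p a x : R) :
  0 < a -> 0 <= x -> a * (x / a) `^ p = x `^ p * a `^ (1 - p).
Proof.
move=> a0 x0; rewrite powRM ?invr_ge0 ?(ltW a0)//.
rewrite powRB ?(gt_eqF a0) ?implybT// powRr1 ?(ltW a0)//.
rewrite -(powR_inv1 (ltW a0)) -powRrM mulN1r powRN; ring.
Qed.

Lemma powR_le_anti (R : realType) (r x y : R) :
  r <= 0 -> 0 < x -> x <= y -> y `^ r <= x `^ r.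
Proof.
move=> r0 x0 xy; have y0 := lt_le_trans x0 xy.
rewrite -[r]opprK !(powRN _ (- r)) lef_pV2 ?posrE ?powR_gt0//.
by apply: ge0_ler_powR => //; rewrite ?oppr_ge0// nnegrE ltW.
Qed.

(* Convexity of the perspective x^p * a^(1-p) of x^p, which is homogeneous of
   degree 1. *)
Lemma powR_perspective_subadditive (R : realType) (p a b x y : R) :
  1 < p -> 0 < a -> 0 < b -> 0 <= x -> 0 <= y ->
  (x + y) `^ p * (a + b) `^ (1 - p) <=
  x `^ p * a `^ (1 - p) + y `^ p * b `^ (1 - p).
Proof.
move=> p1 a0 b0 x0 y0; have ab0 := addr_gt0 a0 b0.
have t0 : 0 <= a / (a + b) by rewrite divr_ge0 ?ltW.
have t1 : a / (a + b) <= 1 by rewrite ler_pdivrMr// mul1r lerDl ltW.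
have := @convex_powR R p (ltW p1) (Itv01 t0 t1) (x / a) (y / b).
rewrite !inE /= !in_itv /= !andbT !divr_ge0 ?(ltW a0) ?(ltW b0)//.
move=> /(_ isT isT); rewrite !convRE /= /unstable.onem => cvx.
rewrite -!mulr_powR_div ?addr_ge0//.
have -> : (x + y) / (a + b) =
    a / (a + b) * (x / a) + (1 - a / (a + b)) * (y / b).
  by field; rewrite !gt_eqF.
apply: le_trans (ler_wpM2l (ltW ab0) cvx) _.
by rewrite le_eqVlt; apply/orP; left; apply/eqP; field; rewrite gt_eqF.
Qed.

(** Induction on [r], merging one pair [t i], [b i] at a time into the accumulated pair, which
    starts as [s] with weight 1. This is Hölder's inequality written with the negative exponent
    [1 - p]. *)
Lemma powR_perspective_sum (R : realType) (p s : R) (I : Type) (r : seq I)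
    (P : pred I) (b t : I -> R) :
  1 < p -> 0 <= s -> (forall i, P i -> 0 < b i) -> (forall i, 0 <= t i) ->
  (s + \sum_(i <- r | P i) t i) `^ p *
    (1 + \sum_(i <- r | P i) b i) `^ (1 - p) <=
  s `^ p + \sum_(i <- r | P i) t i `^ p * b i `^ (1 - p).
Proof.
move=> p1 s0 b0 t0; elim: r => [|i r IH].
  by rewrite !big_nil !addr0 powR1 mulr1.
rewrite !big_cons; case: ifPn => // Pi.
rewrite (addrCA s) (addrCA 1) (addrCA (s `^ p)).
have B0 : 0 < 1 + \sum_(k <- r | P k) b k.
  by rewrite ltr_pwDl// sumr_ge0// => k /b0/ltW.
have T0 : 0 <= s + \sum_(k <- r | P k) t k by rewrite addr_ge0// sumr_ge0.
apply: le_trans (powR_perspective_subadditive _ _ _ _ _ _ p1 (b0 _ Pi) B0 (t0 i) T0) _.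
by rewrite lerD2l.
Qed.

(** Both [x] and [y] are fractions of [x + y] in [0, 1], and such a fraction is at most its [p]-th
    power when [p <= 1]. *)
Lemma powR_subadditive (R : realType) (p x y : R) :
  0 < p <= 1 -> 0 <= x -> 0 <= y -> (x + y) `^ p <= x `^ p + y `^ p.
Proof.
move=> /andP[p0 p1] x0 y0.
have [xy0|xy0] := eqVneq (x + y) 0.
  by rewrite xy0 powR0 ?gt_eqF// addr_ge0// powR_ge0.
have {}xy0 : 0 < x + y by rewrite lt_neqAle eq_sym xy0 addr_ge0.
have frac z : 0 <= z -> z <= x + y -> z / (x + y) * (x + y) `^ p <= z `^ p.
  rewrite le_eqVlt => /predU1P[<-|z0] zxy; first by rewrite !mul0r powR_ge0.
  rewrite -{2}(divfK (lt0r_neq0 xy0) z) powRM ?divr_ge0 ?(ltW z0) ?(ltW xy0)//.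
  rewrite ler_wpM2r ?powR_ge0// ger1_powR// divr_gt0//=.
  by rewrite ler_pdivrMr// mul1r.
have -> : (x + y) `^ p = x / (x + y) * (x + y) `^ p + y / (x + y) * (x + y) `^ p.
  by field; rewrite gt_eqF.
by rewrite lerD// frac// ?lerDl ?lerDr.
Qed.

Lemma powR_sum_subadditive (R : realType) (p s : R) (I : Type) (r : seq I)
    (P : pred I) (t : I -> R) :
  0 < p <= 1 -> 0 <= s -> (forall i, 0 <= t i) ->
  (s + \sum_(i <- r | P i) t i) `^ p <= s `^ p + \sum_(i <- r | P i) t i `^ p.
Proof.
move=> p01 s0 t0; elim: r => [|i r IH]; first by rewrite !big_nil !addr0.
rewrite !big_cons; case: ifPn => // Pi.
rewrite (addrCA s) (addrCA (s `^ p)).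
have T0 : 0 <= s + \sum_(k <- r | P k) t k by rewrite addr_ge0// sumr_ge0.
apply: le_trans (powR_subadditive _ _ _ _ p01 (t0 i) T0) _.
by rewrite lerD2l.
Qed.

(** * Limits of powers of norms and of extended real series *)

Lemma cvg_norm_powR (R : realType) (V : normedModType R) (T : Type)
    (F : set_system T) (f : T -> V) (l : V) (p : R) :
  Filter F -> 0 < p -> (f @ F --> l)%classic ->
  (`|f x| `^ p @[x --> F] --> `|l| `^ p)%classic.
Proof.
move=> FF p0 fl; have [l0|l0] := eqVneq l 0; last first.
  have l0' : 0 < `|l| by rewrite normr_gt0.
  have : {for `|l|, continuous (fun x : R => x `^ p)}.
    apply: differentiable_continuous; apply/derivable1_diffP.
    by apply: derivable_powR; rewrite in_itv/= andbT.
  by move=> c; exact: (continuous_cvg _ c (cvg_norm fl)).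
rewrite l0 in fl *; rewrite normr0 powR0 ?gt_eqF//.
apply/cvgr0Pnorm_lt => e e0.
have d0 : 0 < e `^ p^-1 by rewrite powR_gt0.
apply: filterS (cvgr0_norm_lt f fl _ d0) => x fxd.
rewrite ger0_norm ?powR_ge0// -[ltRHS](powRr1 (ltW e0)).
rewrite -(mulVf (lt0r_neq0 p0)) powRrM.
by apply: gt0_ltr_powR => //; rewrite nnegrE// powR_ge0.
Qed.

(** From index [N] on the partial sums are nonincreasing, so they converge in the extended reals.
    The finite start leaves room for the one positive coefficient. *)
Lemma is_cvg_eventually_npeseries (R : realType) (u : nat -> \bar R) N :
  (forall i, (N <= i)%N -> (u i <= 0)%E) ->
  cvgn (fun n => (\sum_(0 <= i < n) u i)%E).
Proof.
move=> u0; pose v n := (\sum_(0 <= i < n + N) u i)%E.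
have /ereal_nonincreasing_is_cvgn cv : {homo v : n m / (n <= m)%N >-> (m <= n)%E}.
  move=> n m nm; rewrite /v (@big_cat_nat _ _ _ (n + N) 0 (m + N))//= ?leq_add2r//.
  rewrite geeDl// big_nat sume_le0// => i /andP[ni _].
  by rewrite u0// (leq_trans _ ni)// leq_addl.
apply/cvg_ex; exists (limn v).
by rewrite -(cvg_shiftn N).
Qed.

(** * Passage between sequences in [X] and finite real inequalities *)

Lemma sum_nat_D1 (V : nmodType) (n j : nat) (F : nat -> V) : (j < n)%N ->
  \sum_(0 <= i < n) F i = F j + \sum_(0 <= i < n | i != j) F i.
Proof.
by move=> jn; rewrite (bigD1_seq j)//= ?iota_uniq// mem_index_iota.
Qed.

(** The finite inequality is applied to the norm of a partial sum and to the norms of its terms;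
    both sides then pass to the limit. *)
Lemma reverse_triangle_inequality_of_finite (R : realType)
    (X : normedModType R) (p : R) (alpha : nat -> R) (j : nat) :
  0 < p -> 0 < alpha j -> (forall i, i != j -> alpha i < 0) ->
  (forall n s (t : nat -> R), 0 <= s -> (forall i, 0 <= t i) ->
    alpha j * (s + \sum_(0 <= i < n | i != j) t i) `^ p <=
    s `^ p + \sum_(0 <= i < n | i != j) `|alpha i| * t i `^ p) ->
  reverse_triangle_inequality X p alpha.
Proof.
move=> p0 aj0 ai0 fin x _ cx.
have partial n : (j < n)%N ->
    \sum_(0 <= i < n) alpha i * `|x i| `^ p <= `|series x n| `^ p.
  move=> jn; rewrite (sum_nat_D1 _ _ _ _ jn)//.
  have xj : `|x j| <= `|series x n| + \sum_(0 <= i < n | i != j) `|x i|.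
    have -> : x j = series x n - \sum_(0 <= i < n | i != j) x i.
      by rewrite seriesEnat/= (sum_nat_D1 _ _ _ _ jn)// addrK.
    by apply: le_trans (ler_normB _ _) _; rewrite lerD2l ler_norm_sum.
  have := fin n `|series x n| (fun i => `|x i|) (normr_ge0 _) (fun i => normr_ge0 _).
  have -> : \sum_(0 <= i < n | i != j) `|alpha i| * `|x i| `^ p =
      - \sum_(0 <= i < n | i != j) alpha i * `|x i| `^ p.
    rewrite -sumrN; apply: eq_bigr => i ij.
    by rewrite ltr0_norm ?ai0// mulNr.
  rewrite -lerBlDr opprK; apply: le_trans; rewrite lerD2r ler_wpM2l ?(ltW aj0)//.
  by apply: ge0_ler_powR; rewrite ?(ltW p0)// nnegrE// addr_ge0// sumr_ge0.
have cS : ((`|series x n| `^ p)%:E @[n --> \oo] -->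
    (`|limn (series x)| `^ p)%:E)%classic.
  by apply: cvg_EFin; [exact: nearW | exact: cvg_norm_powR].
rewrite -(cvg_lim _ cS)//; apply: lee_lim.
- apply: (@is_cvg_eventually_npeseries _ _ j.+1) => i ji.
  by rewrite lee_fin mulr_le0_ge0 ?powR_ge0// ltW// ai0// gtn_eqF.
- by apply/cvg_ex; eexists; exact: cS.
- by exists j.+1 => // n /= jn; rewrite sumEFin lee_fin partial.
Qed.

(* The test sequences live on a line and have finite support. *)
Lemma reverse_triangle_inequality_finite (R : realType)
    (X : normedModType R) (p : R) (alpha : nat -> R) (j n : nat)
    (a : R) (t : nat -> R) :
  (exists v : X, v != 0) -> 0 < p ->
  reverse_triangle_inequality X p alpha -> (j < n)%N ->
  alpha j * `|a| `^ p + \sum_(0 <= i < n | i != j) alpha i * `|t i| `^ p <=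
  `|a + \sum_(0 <= i < n | i != j) t i| `^ p.
Proof.
move=> [v v0] p0 rti jn.
pose u := `|v|^-1 *: v.
have u1 : `|u| = 1 by rewrite normrZ normfV normr_id mulVf ?normr_eq0.
(* Zeros from [n] on make every series involved eventually constant, so the limits are finite
   sums. *)
pose c i := if (i < n)%N then if i == j then a else t i else 0.
pose x i := c i *: u.
have xc i : `|x i| = `|c i| by rewrite normrZ u1 mulr1.
have tail (V : nmodType) (F : nat -> V) m :
    (forall i, (n <= i)%N -> F i = 0) -> (n <= m)%N ->
    \sum_(0 <= i < m) F i = \sum_(0 <= i < n) F i.
  move=> F0 nm; rewrite (big_cat_nat _ nm)//= [X in _ + X]big_nat [X in _ + X]big1 ?addr0//.
  by move=> i /andP[ni _]; exact: F0.
have c0 i : (n <= i)%N -> c i = 0 by rewrite /c ltnNge => ->.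
have sx : (series x @ \oo --> \sum_(0 <= i < n) x i)%classic.
  apply: cvg_near_cst; exists n => // m /= nm.
  by rewrite seriesEnat/= tail// => i /c0; rewrite /x => ->; rewrite scale0r.
have csx : cvgn (series x) by apply/cvg_ex; eexists; exact: sx.
have cnx : cvgn [normed series x].
  apply/cvg_ex; exists (\sum_(0 <= i < n) `|x i|); apply: cvg_near_cst.
  exists n => // m /= nm; rewrite seriesEnat/= tail// => i /c0.
  by rewrite xc => ->; rewrite normr0.
have := rti x cnx csx; rewrite (cvg_lim _ sx)//.
rewrite (_ : (\sum_(0 <= i <oo) _)%E =
    (\sum_(0 <= i < n) alpha i * `|c i| `^ p)%:E); last first.
  apply: lim_near_cst => //; exists n => // m /= nm.
  rewrite sumEFin; congr EFin; rewrite tail//.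
    by apply: eq_bigr => i _; rewrite xc.
  by move=> i /c0; rewrite xc => ->; rewrite normr0 powR0 ?mulr0// gt_eqF.
rewrite lee_fin /x -scaler_suml normrZ u1 mulr1 !(sum_nat_D1 _ _ _ _ jn).
have -> : c j = a by rewrite /c jn eqxx.
have ct (F G : nat -> R) : (forall i, c i = t i -> F i = G i) ->
    \sum_(0 <= i < n | i != j) F i = \sum_(0 <= i < n | i != j) G i.
  move=> FG; rewrite big_nat_cond [RHS]big_nat_cond; apply: eq_bigr => i.
  by case/andP => /andP[_ ni] ij; apply: FG; rewrite /c ni (negbTE ij).
rewrite (ct c t)//.
rewrite (ct (fun i => alpha i * `|c i| `^ p) (fun i => alpha i * `|t i| `^ p))//.
by move=> i ->.
Qed.

(** * Sufficiency and necessity of the coefficient condition *)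

Lemma coefficient_condition_sufficient (R : realType) (X : normedModType R)
    (p : R) (alpha : nat -> R) (j : nat) :
  0 < p -> 0 < alpha j -> (forall i, i != j -> alpha i < 0) ->
  coefficient_condition p alpha j -> reverse_triangle_inequality X p alpha.
Proof.
move=> p0 aj0 ai0 [cc1 cc2]; apply: (reverse_triangle_inequality_of_finite _ _ _ _ j) => //.
move=> n s t s0 t0; have [p1|p1] := ltP 1 p.
  pose b i := `|alpha i| `^ (1 - p)^-1.
  have np0 : 1 - p != 0 by rewrite lt_eqF// subr_lt0.
  have b0 i : i != j -> 0 < b i.
    by move=> ij; rewrite powR_gt0// normr_gt0 lt_eqF ?ai0.
  have B0 : 0 < 1 + \sum_(0 <= i < n | i != j) b i.
    by rewrite ltr_pwDl// sumr_ge0// => i /b0/ltW.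
  have unb x : 0 <= x -> (x `^ (1 - p)^-1) `^ (1 - p) = x.
    by move=> x0; rewrite -powRrM mulVf// powRr1.
  have aB : alpha j <= (1 + \sum_(0 <= i < n | i != j) b i) `^ (1 - p).
    have {}cc1 : 1 + \sum_(0 <= i < n | i != j) b i <= alpha j `^ (1 - p)^-1.
      rewrite -lee_fin; apply: le_trans (cc1 p1).
      rewrite EFinD leeD2l// -sumEFin.
      by apply: nneseries_lim_ge => i _ _; rewrite lee_fin powR_ge0.
    (* Raising to the negative power [1 - p] undoes the exponent [(1 - p)^-1] and reverses [cc1]. *)
    rewrite -[leLHS](unb _ (ltW aj0)); apply: powR_le_anti => //.
    by rewrite subr_le0 ltW.
  apply: le_trans (ler_wpM2r (powR_ge0 _ _) aB) _; rewrite mulrC.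
  apply: le_trans (powR_perspective_sum _ _ _ _ _ _ _ _ p1 s0 b0 t0) _.
  rewrite lerD2l; apply: ler_sum => i ij.
  by rewrite unb// mulrC.
have {}cc2 := cc2 p1.
have lbS : has_lbound ([set 1] `|` [set `|alpha i| | i in [set i | i != j]])%classic.
  by exists 0 => _ [->|[i _ <-]].
have aj1 : alpha j <= 1 by apply: le_trans cc2 _; apply: ge_inf => //; left.
have aji i : i != j -> alpha j <= `|alpha i|.
  by move=> ij; apply: le_trans cc2 _; apply: ge_inf => //; right; exists i.
have p01 : 0 < p <= 1 by rewrite p0.
apply: le_trans (ler_wpM2l (ltW aj0) (powR_sum_subadditive _ _ _ _ _ _ _ p01 s0 t0)) _.
rewrite mulrDr mulr_sumr; apply: lerD.
  by rewrite ler_piMl// powR_ge0.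
by apply: ler_sum => i ij; rewrite ler_wpM2r ?powR_ge0 ?aji.
Qed.

Lemma positive_coefficient_dominated (R : realType) (X : normedModType R)
    (p : R) (alpha : nat -> R) (i j : nat) :
  (exists v : X, v != 0) -> 0 < p ->
  reverse_triangle_inequality X p alpha -> i != j -> alpha j <= - alpha i.
Proof.
move=> X0 p0 rti ij.
(* With 1 at [j] and -1 at [i] the sum vanishes, and 0 to the power [p] is 0 because [p] is
   nonzero. *)
pose t k : R := if k == i then -1 else 0.
have jn : (j < (maxn i j).+1)%N by rewrite ltnS leq_maxr.
have i_n : (i < (maxn i j).+1)%N by rewrite ltnS leq_maxl.
have := reverse_triangle_inequality_finite _ _ _ _ _ _ 1 t X0 p0 rti jn.
have one (F : nat -> R) : (forall k, k != i -> F k = 0) ->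
    \sum_(0 <= k < (maxn i j).+1 | k != j) F k = F i.
  move=> F0; rewrite big_mkcond (sum_nat_D1 _ _ _ _ i_n)//= ij big1 ?addr0// => k ki.
  by case: ifP => // _; exact: F0.
have ti0 k : k != i -> t k = 0 by rewrite /t => /negbTE ->.
rewrite (one t ti0) (one (fun k => alpha k * `|t k| `^ p)); last first.
  by move=> k /ti0 ->; rewrite normr0 powR0 ?mulr0// gt_eqF.
rewrite /t eqxx.
by rewrite normrN normr1 powR1 !mulr1 subrr normr0 powR0 ?gt_eqF// -lerBrDr sub0r.
Qed.

Lemma coefficient_condition_necessary (R : realType) (X : normedModType R)
    (p : R) (alpha : nat -> R) (j : nat) :
  (exists v : X, v != 0) -> 0 < p ->
  reverse_triangle_inequality X p alpha -> 0 < alpha j ->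
  coefficient_condition p alpha j.
Proof.
move=> X0 p0 rti aj0.
have ai0 i : i != j -> alpha i < 0.
  move=> ij; rewrite -oppr_gt0; apply: lt_le_trans aj0 _.
  exact: positive_coefficient_dominated rti ij.
split=> p1; last first.
  apply: lb_le_inf; first by exists 1; left.
  move=> _ [->|[i /= ij <-]].
    (* A single nonzero term, at [j], gives the bound by 1. *)
    have := reverse_triangle_inequality_finite _ _ _ _ _ _ 1 (fun=> 0) X0 p0 rti (ltnSn j).
    rewrite !big1 ?addr0 ?normr1 ?powR1 ?mulr1// => i _.
    by rewrite normr0 powR0 ?mulr0// gt_eqF.
  by rewrite ltr0_norm ?ai0//; exact: positive_coefficient_dominated rti ij.
pose b i := `|alpha i| `^ (1 - p)^-1.
pose A := alpha j `^ (1 - p)^-1.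
have np0 : 1 - p != 0 by rewrite lt_eqF// subr_lt0.
have A0 : 0 < A by rewrite powR_gt0.
have b0 i : i != j -> 0 < b i.
  by move=> ij; rewrite powR_gt0// normr_gt0 lt_eqF ?ai0.
(* Since 1 + p/(1-p) = 1/(1-p), the weighted power of [A] is [A] itself, and that of [b i] is [b i]
   up to sign. *)
have mulb x : 0 < x -> x * (x `^ (1 - p)^-1) `^ p = x `^ (1 - p)^-1.
  move=> x0; rewrite -powRrM -{1}(powRr1 (ltW x0)) -powRD ?(gt_eqF x0) ?implybT//.
  by congr (_ `^ _); field.
suff finite n : (j < n)%N -> 1 + \sum_(0 <= i < n | i != j) b i <= A.
  rewrite -leeBrDl// -EFinB; apply: lime_le.
    by apply: is_cvg_nneseries_cond => i _ _; rewrite lee_fin powR_ge0.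
  by exists j.+1 => // n /= /finite; rewrite sumEFin lee_fin lerBrDl.
move=> jn; set B := \sum_(0 <= i < n | i != j) b i.
have B0 : 0 <= B by rewrite sumr_ge0// => i /b0/ltW.
(* [x_j = A] and [x_i = - c b_i], with [c <= 1] chosen so that the norm of the
   sum is [e < 1], whereas the weighted sum of powers is at least [A - c B = e]. *)
rewrite leNgt; apply/negP => AB.
(* When [B < A], the choice [A - B] is below 1 exactly by [AB]; otherwise any positive [e] below 1
   and at most [A] will do. *)
have [e /andP[e0 e1] /andP[eA Ae]] : exists2 e, 0 < e < 1 & (e <= A) && (A - e <= B).
  have [AleB|BltA] := leP A B.
    exists (Num.min A 2^-1); first by rewrite lt_min A0 gt_min /=; lra.
    have : 0 < Num.min A 2^-1 by rewrite lt_min A0 /=; lra.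
    by rewrite ge_min lexx /=; lra.
  by exists (A - B); lra.
have [c /andP[c0 c1] cB] : exists2 c, 0 <= c <= 1 & A - c * B = e.
  have [B00|B0'] := eqVneq B 0; first by exists 0; [lra|move: Ae eA; rewrite B00; lra].
  have {}B0' : 0 < B by rewrite lt_neqAle eq_sym B0'.
  exists ((A - e) / B); last by field; rewrite gt_eqF.
  by rewrite divr_ge0 ?subr_ge0//= ler_pdivrMr// mul1r.
have := reverse_triangle_inequality_finite _ _ _ _ _ _ A (fun i => - (c * b i)) X0 p0 rti jn.
rewrite sumrN -mulr_sumr -/B cB (gtr0_norm e0) (gtr0_norm A0) mulb//.
have -> : \sum_(0 <= i < n | i != j) alpha i * `|- (c * b i)| `^ p = - (c `^ p * B).
  rewrite mulr_sumr -sumrN; apply: eq_bigr => i ij.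
  rewrite normrN ger0_norm ?mulr_ge0 ?(ltW (b0 _ ij))// powRM ?(ltW (b0 _ ij))//.
  rewrite -{2}/(b i) -{2}[b i]mulb ?normr_gt0 ?lt_eqF ?ai0// -/(b i).
  by rewrite ltr0_norm ?ai0//; ring.
have cp : c `^ p <= c.
  have [->|cn0] := eqVneq c 0; first by rewrite powR0 ?gt_eqF.
  by apply: ge1r_powR; rewrite ?(ltW p1)// c1 lt_neqAle eq_sym cn0 c0.
have ep : e `^ p < e.
  rewrite -mulr_powRB1 ?(ltW e0)// -[ltRHS]mulr1 ltr_pM2l//.
  have : e `^ (p - 1) < 1 `^ (p - 1).
    by apply: gt0_ltr_powR; rewrite ?subr_gt0// nnegrE// ltW.
  by rewrite powR1.
(* The test inequality reads A - c^p B <= e^p, whereas e^p < e = A - c B <= A - c^p B. *)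
apply/negP; rewrite -ltNge; apply: lt_le_trans ep _.
by rewrite -cB lerD2l lerN2 ler_wpM2r.
Qed.

(** In the zero space the inequality holds for every [alpha], hence [X_neq0]. The first alternative
    is not strict, since zero coefficients also satisfy the inequality. *)
Theorem theorem3p2 (R : realType) (X : normedModType R)
    (X_neq0 : exists v : X, v != 0)
    (p : R) (p_gt0 : 0 < p) (alpha : nat -> R) :
  reverse_triangle_inequality X p alpha <->
  (forall i : nat, alpha i <= 0) \/
  (exists! j : nat,
      0 < alpha j /\
      (forall i : nat, i != j -> alpha i < 0) /\
      coefficient_condition p alpha j).
Proof.
split=> [rti|[alpha_le0|[j [[aj0 [ai0 cc]] _]]]]; last first.
- exact: coefficient_condition_sufficient cc.
- move=> x _ _; apply: (@le_trans _ _ 0%E); last by rewrite lee_fin powR_ge0.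
  by apply: npeseries_le0 => i _ _; rewrite lee_fin mulr_le0_ge0 ?powR_ge0.
have [|/existsNP[j /negP]] := pselect (forall i, alpha i <= 0); first by left.
rewrite -ltNge => aj0; right; exists j.
have ai0 i : i != j -> alpha i < 0.
  move=> ij; rewrite -oppr_gt0; apply: lt_le_trans aj0 _.
  exact: positive_coefficient_dominated rti ij.
split=> [|k [ak0 _]]; first by split=> //; split=> //; exact: coefficient_condition_necessary rti aj0.
(* A second index with positive coefficient would contradict [ai0]. *)
apply/eqP/negPn/negP; rewrite eq_sym => kj.
by have := lt_trans ak0 (ai0 _ kj); rewrite ltxx.
Qed.
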